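(* Let $A$ be an integral domain, $E$ an $A$-module and $a\in W(E)^{\#}$. The following are equivalent: (i) $[a]\in\operatorname{EC}(W(E)^{\#})$ is an isolated point of $qD_A(E)$; (ii) $U_a=\{[a]\}$; (iii) $aE$ is a maximal element (with respect to inclusion) of the set $\{bE: b\in W(E)^{\#}\}$.
   Context: For an $A$-module $E$: $\operatorname{ann}(E)=\{a\in A: aE=0\}$, $W(E)=\{a\in A: aE\neq E\}$, $W(E)^{\#}=W(E)\setminus\operatorname{ann}(E)$. On $W(E)^{\#}$ put $a\sim b$ iff $aE=bE$; $[a]$ is the class of $a$ and $\operatorname{EC}(W(E)^{\#})$ is the set of all classes. For $a\in W(E)^{\#}$, $U_a=\{[b]\in\operatorname{EC}(W(E)^{\#}): aE\subseteq bE\}$. The quasi divisor topology $qD_A(E)$ is the topological space $\operatorname{EC}(W(E)^{\#})$ whose topology has basis $\{U_a\}_{a\in W(E)^{\#}}$. A point $x$ is isolated if $\{x\}$ is open. *)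

(* Defs.v *)
(* Library: MathComp + MathComp-Analysis *)
From HB Require Import structures.
From mathcomp Require Import all_boot all_order all_algebra.
From mathcomp Require Import all_classical topology_structure.

Set Implicit Arguments.
Unset Strict Implicit.
Unset Printing Implicit Defensive.

Import GRing.Theory.
Local Open Scope classical_set_scope.
Local Open Scope ring_scope.

Definition smulset (A : idomainType) (E : lmodType A) (a : A) : set E :=
  [set a *: x | x in [set: E]].
Arguments smulset {A} E a.

Definition ann (A : idomainType) (E : lmodType A) : set A :=
  [set a | smulset E a = [set 0]].

Definition W (A : idomainType) (E : lmodType A) : set A :=
  [set a | smulset E a <> [set: E]].

Definition Wsharp (A : idomainType) (E : lmodType A) : set A := W E `\` ann E.

(* A set used as a type (Wsharp E, EC E) is the subtype of its elements. *)
Definition sim (A : idomainType) (E : lmodType A) (a b : Wsharp E) : Prop :=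
  smulset E (val a) = smulset E (val b).

Definition sim_class (A : idomainType) (E : lmodType A) (a : Wsharp E) :
  set (Wsharp E) := [set b | sim a b].

Definition EC (A : idomainType) (E : lmodType A) : set (set (Wsharp E)) :=
  range (@sim_class A E).
Arguments EC {A} E.

(* The point set of the quasi divisor topology; it is an alias of the subtype
   EC E that carries the topological structure declared below. *)
Definition qD (A : idomainType) (E : lmodType A) : Type := EC E.
HB.instance Definition _ (A : idomainType) (E : lmodType A) :=
  Choice.on (qD E).

Definition cls (A : idomainType) (E : lmodType A) (a : Wsharp E) : qD E :=
  SigSub (mem_set (imageT (@sim_class A E) a)).

Definition U (A : idomainType) (E : lmodType A) (a : Wsharp E) : set (qD E) :=
  [set cls b | b in [set b : Wsharp E |
                     smulset E (val a) `<=` smulset E (val b)]].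

Lemma cls_surj (A : idomainType) (E : lmodType A) (x : qD E) :
  exists a, x = cls a.
Proof.
case: x => C hC; have [a _ ea] := set_mem hC.
by exists a; apply: val_inj; rewrite /= ea.
Qed.

Lemma mem_U (A : idomainType) (E : lmodType A) (a b : Wsharp E) :
  U a (cls b) <-> smulset E (val a) `<=` smulset E (val b).
Proof.
split=> [[c /= ac cb]|ab]; last by exists b.
suff: sim c b by rewrite /sim => <-.
have : sim_class b b by [].
by move/(congr1 val): cb => /= <-.
Qed.

Lemma U_cover (A : idomainType) (E : lmodType A) :
  \bigcup_(V in range (@U A E)) V = setT.
Proof.
rewrite -subTset => x _; have [a ->] := cls_surj x.
by exists (U a); [exists a|apply/mem_U].
Qed.

Lemma U_join (A : idomainType) (E : lmodType A) (V V' : set (qD E)) (x : qD E) :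
  range (@U A E) V -> range (@U A E) V' -> V x -> V' x ->
  exists V'', [/\ range (@U A E) V'', V'' x & V'' `<=` V `&` V'].
Proof.
have [c ->] := cls_surj x.
move=> [a _ <-] [b _ <-] /mem_U ac /mem_U bc.
exists (U c); split; [by exists c|exact/mem_U|].
by move=> y; have [d ->] := cls_surj y => /mem_U cd; split;
  apply/mem_U; apply: subset_trans cd.
Qed.

(* The topology with basis {U_a : a in W(E)^#}. *)
HB.instance Definition _ (A : idomainType) (E : lmodType A) :=
  @isBaseTopological.Build (qD E) (set (qD E)) (range (@U A E)) id
    (U_cover E) (@U_join A E).

Definition isolated_point (T : topologicalType) (x : T) : Prop :=
  open [set x].

Definition maximal_in (T : Type) (S : set (set T)) (X : set T) : Prop :=
  S X /\ forall Y, S Y -> X `<=` Y -> X = Y.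

(* Main.v *)
Require Import Defs.
From mathcomp Require Import all_boot all_order all_algebra.
From mathcomp Require Import all_classical topology_structure.

Local Open Scope classical_set_scope.
Local Open Scope ring_scope.

(** The topology is an Alexandrov topology: the basic set U_a is itself open
    and is the smallest open set containing [a], because every basic set
    U_c containing [a] satisfies cE <= aE, hence contains U_a.  Therefore
    {[a]} is open exactly when U_a is reduced to [a].  As the points of U_a
    are the classes [b] with aE <= bE, and classes are determined by the
    submodules bE, this says that no bE strictly contains aE. *)

Lemma cls_eqP (A : idomainType) (E : lmodType A) (a b : Wsharp E) :
  cls a = cls b <-> smulset E (val a) = smulset E (val b).
Proof.
split=> [/(congr1 val) /= ab|ab].
  (* b belongs to its own class, hence to the class of a. *)
  have : sim_class b b by [].
  by rewrite -ab.
apply: val_inj => /=; apply/seteqP.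
by split=> c; rewrite /sim_class /= /sim ab.
Qed.

Lemma open_U (A : idomainType) (E : lmodType A) (a : Wsharp E) : open (U a).
Proof.
exists [set U a]; first by move=> _ ->; exists a.
by rewrite bigcup_set1.
Qed.

(** With [open_U], this makes [U a] the smallest open set containing
    [cls a]: inclusion of submodules is transitive, so a basic set containing
    [cls a] contains everything above it. *)
Lemma U_sub_open (A : idomainType) (E : lmodType A) (a : Wsharp E)
    (V : set (qD E)) :
  open V -> V (cls a) -> U a `<=` V.
Proof.
move=> [D DU <-] [X DX Xa] x; have [b ->] := cls_surj x => /mem_U ab.
exists X => //; have [c _ Xc] := DU _ DX.
rewrite -Xc in Xa *; move/mem_U: Xa => ca.
by apply/mem_U; apply: subset_trans ab.
Qed.

Theorem theorem1 (A : idomainType) (E : lmodType A) (a : Wsharp E) :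
  [<-> isolated_point (cls a);
       U a = [set cls a];
       maximal_in [set smulset E b | b in Wsharp E] (smulset E (val a))].
Proof.
have Uaa : U a (cls a) by apply/mem_U.
tfae.
- move=> oa; apply/seteqP; split; first exact: U_sub_open.
  by move=> _ ->.
- move=> Ua; split; first by exists (val a) => //; apply: set_valP.
  move=> _ [b Wb <-] ab; pose b' : Wsharp E := SigSub (mem_set Wb).
  have : U a (cls b') by apply/mem_U.
  by rewrite Ua => /cls_eqP.
- move=> [_ amax].
  have Ua : U a = [set cls a].
    apply/seteqP; split; last by move=> _ ->.
    move=> x; have [b ->] := cls_surj x => /mem_U ab.
    apply/cls_eqP/esym/amax => //.
    by exists (val b) => //; apply: set_valP.
  by rewrite /isolated_point -Ua; apply: open_U.
Qed.
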